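(* Let $n\in\mathbb{Z}_{\ge 1}$ and let $q\in\mathbb{R}$ with $0<q<\lfloor n/2\rfloor$ and fractional part $\widehat q := q-\lfloor q\rfloor\neq 0$. Then the SOS rank of the unweighted minimum knapsack instance $\mathrm{MK}(q)$ on $n$ variables is lower bounded by $$ \begin{cases} \Omega\left(\min\left\{n,\ \sqrt{n\log(1/\widehat q)}\right\}\right) & \text{if } 0<\widehat q\le 1/2,\\[4pt] \Omega\left(\sqrt{n(1-\widehat q)}\right) & \text{if } 1/2<\widehat q<1, \end{cases} $$ where the constants implied by $\Omega(\cdot)$ are absolute (independent of $n$ and $q$).
   Context: For $\mathbf{x}\in\{0,1\}^n$ write $|\mathbf{x}|=\sum_{i=1}^n x_i$. The instance $\mathrm{MK}(q)$ is the problem of minimizing $|\mathbf{x}|$ subject to $|\mathbf{x}|\ge q$, $\mathbf{x}\in\{0,1\}^n$; for $0\le q\le n$ its optimal value is $\lceil q\rceil$. A polynomial in $\mathbb{R}[x_1,\dots,x_n]$ is SOS if it is a finite sum of squares of real polynomials. For $0\le q\le n$, a degree-$d$ SOS certificate of optimality for $\mathrm{MK}(q)$ consists of SOS polynomials $s_0,s_1\in\mathbb{R}[x_1,\dots,x_n]$ with $\deg(s_0)\le 2d+2$, $\deg(s_1)\le 2d$ and $$|\mathbf{x}|-\lceil q\rceil = s_0(\mathbf{x})+s_1(\mathbf{x})(|\mathbf{x}|-q)\quad\text{for all }\mathbf{x}\in\{0,1\}^n.$$ The SOS rank of $\mathrm{MK}(q)$ is the smallest $d\in\mathbb{Z}_{\ge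 0}$ for which such a certificate exists. *)

(* Defs.v *)
From HB Require Import structures.
From mathcomp Require Import all_boot all_order all_algebra.
From mathcomp Require Import mpoly.
From mathcomp Require Import boolp reals exp.

Set Implicit Arguments.
Unset Strict Implicit.
Unset Printing Implicit Defensive.

Import Order.TTheory GRing.Theory Num.Theory.

Local Open Scope ring_scope.

Section MinKnapsack.
Variables (R : realType) (n : nat).
Implicit Types (p s : {mpoly R[n]}) (x : {ffun 'I_n -> bool}) (q : R).

Definition is_sos s : Prop :=
  exists ps : seq {mpoly R[n]}, s = \sum_(p <- ps) p ^+ 2.

(* [msize p] is [deg p + 1] for [p != 0] and [msize 0 = 0], so the zero
   polynomial satisfies every degree bound. *)
Definition deg_le p (k : nat) : Prop := (msize p <= k.+1)%N.

Definition cube_eval p x : R := p.@[fun i => (x i)%:R].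

Definition weight x : R := \sum_i (x i)%:R.

Definition sos_certificate q (d : nat) : Prop :=
  exists s0 s1 : {mpoly R[n]},
    [/\ is_sos s0, is_sos s1,
        deg_le s0 (2 * d + 2), deg_le s1 (2 * d) &
        forall x, weight x - (Num.ceil q)%:~R
                  = cube_eval s0 x + cube_eval s1 x * (weight x - q)].

Definition cube_delta x : {mpoly R[n]} :=
  \prod_i (if x i then 'X_i else 1 - 'X_i).

Definition cube_interp (f : {ffun 'I_n -> bool} -> R) : {mpoly R[n]} :=
  \sum_x f x *: cube_delta x.

Lemma cube_eval_delta x y : cube_eval (cube_delta x) y = (x == y)%:R.
Proof.
rewrite /cube_eval /cube_delta rmorph_prod /=; case: eqVneq => [<-|neq_xy].
  by rewrite big1// => i _; case: (x i) / (boolP (x i)) => xi;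
    rewrite ?mevalB ?meval1 mevalXU ?xi ?(negbTE xi) ?subr0.
have [i ixy] : exists i, x i != y i.
  by apply/existsP; apply: contraNT neq_xy; rewrite negb_exists =>
    /forallP e; apply/eqP/ffunP => i; apply/eqP; rewrite -[_ == _]negbK.
rewrite (bigD1 i)//= -[RHS](mul0r (\prod_(j | j != i)
  (if x j then 'X_j else 1 - 'X_j).@[fun i => (y i)%:R])); congr (_ * _).
move: ixy; case: (x i); case yi: (y i) => // _;
  by rewrite ?mevalB ?meval1 mevalXU yi ?subrr.
Qed.

Lemma cube_eval_interp f y : cube_eval (cube_interp f) y = f y.
Proof.
rewrite /cube_eval /cube_interp raddf_sum /= (bigD1 y)//= big1 => [|x neq_xy].
  by rewrite mevalZ -/(cube_eval _ _) cube_eval_delta eqxx mulr1 addr0.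
by rewrite mevalZ -/(cube_eval _ _) cube_eval_delta (negbTE neq_xy) mulr0.
Qed.

Lemma deg_leM p s k l : deg_le p k -> deg_le s l -> deg_le (p * s) (k + l).
Proof.
rewrite /deg_le => le_pk le_sl.
have [->|p0] := eqVneq p 0; first by rewrite mul0r msize0.
have [->|s0] := eqVneq s 0; first by rewrite mulr0 msize0.
by rewrite msizeM// -subn1 leq_subLR add1n -addnS -addSn leq_add.
Qed.

Lemma deg_le_delta x : deg_le (cube_delta x) n.
Proof.
rewrite -[X in deg_le _ X]card_ord -sum1_card /cube_delta.
elim/big_rec2: _ => [|i k p _ le_pk]; first by rewrite /deg_le msize1.
apply: deg_leM le_pk; rewrite /deg_le.
case: (x i) => /=; first by rewrite msizeX mdeg1.
by apply: leq_trans (msizeD_le _ _) _; rewrite msizeN msize1 msizeX mdeg1.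
Qed.

Lemma deg_le_interp_sqr f : deg_le (cube_interp f ^+ 2) (2 * n).
Proof.
have le_n : deg_le (cube_interp f) n.
  apply: leq_trans (msize_sum _ _ _) _; apply/bigmax_leqP_seq => x _ _.
  exact: leq_trans (msizeZ_le _ _) (deg_le_delta x).
by rewrite expr2 mul2n -addnn; apply: deg_leM.
Qed.

Lemma sos_certificate_exists q : exists d, `[< sos_certificate q d >].
Proof.
pose v x : R := weight x - (Num.ceil q)%:~R.
(* On points of weight below [q] the multiplier [s1] absorbs the negative
   value [v x]. *)
pose m x : R := if weight x < q then v x / (weight x - q) else 0.
exists n; apply/asboolP.
pose a x : R := v x - m x * (weight x - q).
have weightE x : weight x = (\sum_i x i)%N%:R by rewrite /weight natr_sum.
have vq x : v x <= weight x - q by rewrite lerD2l lerN2 ceil_ge.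
have m_ge0 x : 0 <= m x.
  rewrite /m; case: ifP => // ltq; apply: mulr_le0.
    by apply: le_trans (vq x) _; rewrite subr_le0 ltW.
  by rewrite invr_le0 subr_le0 ltW.
have a_ge0 x : 0 <= a x.
  rewrite /a /m; case: (ltP (weight x) q) => [ltq|leq].
    by rewrite divfK ?subrr// lt_eqF// subr_lt0.
  rewrite mul0r subr0 subr_ge0 weightE -[X in _ <= X]mulrz_nat ler_int.
  by rewrite ceil_le_int mulrz_nat -weightE.
exists (cube_interp (fun x => Num.sqrt (a x)) ^+ 2),
       (cube_interp (fun x => Num.sqrt (m x)) ^+ 2).
split.
- by exists [:: cube_interp (fun x => Num.sqrt (a x))]; rewrite big_seq1.
- by exists [:: cube_interp (fun x => Num.sqrt (m x))]; rewrite big_seq1.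
- apply: leq_trans (deg_le_interp_sqr _) _.
  by rewrite ltnS leq_addr.
- exact: deg_le_interp_sqr.
move=> x; rewrite /cube_eval !rmorphXn /= -!/(cube_eval _ _) !cube_eval_interp.
by rewrite !sqr_sqrtr// /a subrK.
Qed.

Definition sos_rank q : nat := ex_minn (sos_certificate_exists q).

End MinKnapsack.

Arguments sos_rank {R} n q.

(* Main.v *)
(** In a degree-[d] certificate, average the multiplier [s1] over the points of
    weight [t]: this gives a univariate polynomial [p] of degree at most [2d].
    With [k = floor q] and [qh = q - k], the certificate forces
    [p(k) >= 1 / qh], [p(k+1) = 0] and [0 <= p(t) <= 1] for [t = k+1, ..., n].
    So [p], shifted by [k+1], is bounded by 1 on [0, ..., N] for some
    [N >= n / 2] but is at least [1 / qh] at [-1].  Lagrange interpolation at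
    [-1] limits this jump.  With nodes [64 i^2], [i <= 2d], the value at [-1] is
    at most [1/2] as soon as the nodes fit, whence [n <= 512 d^2].  With
    clusters of [B] consecutive integers starting at [64 B i^2], the value is at
    most [64^B]; taking [B] of order [1 + d^2 / n] gives
    [log (1 / qh) = O(1 + d^2 / n)]. *)

Require Import Defs.
From HB Require Import structures.
From mathcomp Require Import all_boot all_order all_algebra.
From mathcomp Require Import mpoly.
From mathcomp Require Import boolp reals exp.
From mathcomp Require Import zify ring lra.

Set Implicit Arguments.
Unset Strict Implicit.
Unset Printing Implicit Defensive.

Import Order.TTheory GRing.Theory Num.Theory.

Local Open Scope ring_scope.

(** * Lagrange interpolation and products of integer distances *)

(** [p] minus its interpolant has size at most [#|I|] but vanishes at [#|I|] distinct points, so it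
    is zero. *)
Lemma horner_lagrange (F : fieldType) (I : finType) (y : I -> F)
    (p : {poly F}) z :
  injective y -> (size p <= #|I|)%N ->
  p.[z] = \sum_i p.[y i] * \prod_(j | j != i) ((z - y j) / (y i - y j)).
Proof.
move=> y_inj le_pI.
pose b i := \prod_(j | j != i) ((y i - y j)^-1 *: ('X - (y j)%:P)).
have bE i x : (b i).[x] = \prod_(j | j != i) ((x - y j) / (y i - y j)).
  rewrite horner_prod; apply: eq_bigr => j _.
  by rewrite hornerZ hornerXsubC mulrC.
pose r := \sum_i p.[y i] *: b i.
have rE x : r.[x] = \sum_i p.[y i] * \prod_(j | j != i) ((x - y j) / (y i - y j)).
  by rewrite horner_sum; apply: eq_bigr => i _; rewrite hornerZ bE.
suff /eqP : p - r == 0 by move/subr0_eq => e; rewrite -rE -e.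
apply/negPn/negP => pr0.
have : all (root (p - r)) [seq y i | i <- enum I].
  apply/allP => _ /mapP[i _ ->]; rewrite /root hornerD hornerN subr_eq0 rE.
  rewrite (bigD1 i)//= [X in _ * X + _]big1 => [|j ji]; last first.
    by rewrite divff// subr_eq0 (inj_eq y_inj) eq_sym.
  rewrite mulr1 big1 ?addr0// => k ki.
  by rewrite (bigD1 i) 1?eq_sym//= subrr !mul0r mulr0.
have u : uniq [seq y i | i <- enum I] by rewrite map_inj_uniq ?enum_uniq.
move=> /(max_poly_roots pr0)/(_ u); rewrite size_map -cardE.
apply/negP; rewrite -leqNgt (leq_trans (size_polyD _ _))// geq_max le_pI size_polyN.
rewrite (leq_trans (size_sum _ _ _))//; apply/bigmax_leqP => i _.
rewrite (leq_trans (size_scale_leq _ _))// /b scaler_prod.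
rewrite (leq_trans (size_scale_leq _ _))// -big_filter size_prod_XsubC.
by rewrite size_filter -sum1_count -sum1_card [X in (_ <= X)%N](bigD1 i)//= add1n.
Qed.

(** Each side of [i] is reindexed by the distance [j.+1] to [i], the form in which factorials and
    sums of inverse squares appear. *)
Lemma big_ord_neq (T : Type) (idx : T) (op : Monoid.com_law idx)
    (G : nat -> T) m i : (i <= m)%N ->
  \big[op/idx]_(j < m.+1 | j != i :> nat) G j =
    op (\big[op/idx]_(j < i) G (i - j.+1)%N)
       (\big[op/idx]_(j < m - i) G (i + j.+1)%N).
Proof.
move=> le_im.
rewrite -(big_mkord (fun j => j != i) G) (@big_cat_nat _ _ _ i)//=; last exact: leqW.
congr (op _ _).
  rewrite -(big_mkord xpredT (fun j => G (i - j.+1)%N)) (big_nat_rev _ _ 0%N)/=.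
  rewrite big_nat_cond [RHS]big_nat_cond; apply: eq_big => [j|j /andP[/andP[_ ji] _]].
    by rewrite andbT; lia.
  by congr G; lia.
rewrite -(big_mkord xpredT (fun j => G (i + j.+1)%N)).
rewrite big_ltn_cond ?ltnS// eqxx /=.
rewrite -{1}[i.+1]add0n big_addn subSS.
rewrite big_nat_cond [RHS]big_nat_cond; apply: eq_big => [j|j _].
  by rewrite andbT; lia.
by congr G; lia.
Qed.

Lemma prod_dist_ord m i : (i <= m)%N ->
  (\prod_(j < m.+1 | j != i :> nat) `|j%:Z - i%:Z| = (i`! * (m - i)`!)%N%:Z).
Proof.
move=> le_im; rewrite (big_ord_neq _ (fun j => `|j%:Z - i%:Z|))//=.
rewrite PoszM; congr (_ * _).
  rewrite fact_prod -(big_mkord xpredT (fun j => `|(i - j.+1)%N%:Z - i%:Z|)).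
  rewrite -[i in RHS]/(i.+1.-1) (big_add1 _ _ 0%N) /=  (big_morph Posz PoszM (erefl _)).
  by rewrite !big_nat; apply: eq_bigr => j ji; lia.
rewrite fact_prod -(big_mkord xpredT (fun j => `|(i + j.+1)%N%:Z - i%:Z|)).
rewrite (big_add1 _ _ 0%N) /= (big_morph Posz PoszM (erefl _)).
by apply: eq_bigr => j _; lia.
Qed.

Lemma fact_rising i m : (i`! * \prod_(j < m) (i + j.+1) = (i + m)`!)%N.
Proof.
elim: m => [|m IHm]; first by rewrite big_ord0 muln1 addn0.
by rewrite big_ord_recr/= mulnA IHm addnS factS mulnC.
Qed.

(** For [i > 0] this is an equality: the numbers from i to i + m multiply to (i + m)! / (i - 1)!,
    and the omitted factor [j = i] is 2 i. For [i = 0] the 2 is slack. *)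
Lemma fact_le_prod_add m i : (i <= m)%N ->
  ((i + m)`! <= 2 * i`! * \prod_(j < m.+1 | j != i :> nat) (j + i))%N.
Proof.
case: i => [|i] le_im.
  rewrite (big_ord_neq _ (fun j => (j + 0)%N))//= big_ord0 !mul1n muln1 subn0 add0n.
  under eq_bigr => j _ do rewrite addn0.
  rewrite -[X in (_ <= 2 * X)%N]mul1n -[X in (_ <= 2 * (X * _))%N]fact0.
  by rewrite fact_rising leq_pmull.
suff -> : (i.+1 + m)`! =
    (2 * i.+1`! * \prod_(j < m.+1 | j != i.+1 :> nat) (j + i.+1))%N by [].
have lt_im : (i.+1 < m.+1)%N by [].
rewrite addSnnS -fact_rising (bigD1 (Ordinal lt_im))//= factS.
under [in RHS]eq_bigr => j _ do rewrite addnC addSnnS.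
by rewrite (_ : i + i.+2 = 2 * i.+1)%N; [ring | lia].
Qed.

Lemma leq_sqr_fact m i : (i <= m)%N -> (m`! ^ 2 <= (m - i)`! * (m + i)`!)%N.
Proof.
move=> le_im; have e : (m`! = (m - i)`! * \prod_(j < i) (m - i + j.+1))%N.
  by rewrite fact_rising subnK.
rewrite -mulnn -(fact_rising m i) {1}e -mulnA leq_mul2l; apply/orP; right.
rewrite mulnC leq_mul2l; apply/orP; right.
by apply: leq_prod => j _; rewrite leq_add2r leq_subr.
Qed.

(** Split j^2 - i^2 as (j - i)(j + i): the differences multiply to i! (m - i)! in absolute value,
    the sums to at least (m + i)! / (2 i!). *)
Lemma prod_dist_sqr_ge m i : (i <= m)%N ->
  (m`! ^ 2)%N%:Z <=
    2 * \prod_(j < m.+1 | j != i :> nat) `|j%:Z ^+ 2 - i%:Z ^+ 2|.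
Proof.
move=> le_im; under eq_bigr => j _ do rewrite subr_sqr normrM.
rewrite big_split/= prod_dist_ord//.
under [X in _ <= _ * (_ * X)]eq_bigr => j _ do rewrite -PoszD ger0_norm//.
rewrite -(big_morph Posz PoszM (erefl 1%Z)) -!PoszM lez_nat.
apply: leq_trans (leq_sqr_fact le_im) _.
rewrite addnC; apply: leq_trans (leq_mul (leqnn _) (fact_le_prod_add le_im)) _.
by apply: eq_leq; ring.
Qed.

(** * Real estimates for perturbed quadratic nodes *)

Section RealBounds.
Variable F : realFieldType.
Implicit Types (M a d : F) (m i j : nat).

Lemma sum_inv_sqr_le m : \sum_(j < m) (j.+1%:R ^+ 2)^-1 <= 2 :> F.
Proof.
(* The subtracted [m%:R^-1] makes the induction telescope; at [m = 0] it is 0 by convention. *)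
suff : \sum_(j < m) (j.+1%:R ^+ 2)^-1 <= 2 - m%:R^-1 :> F.
  by move/le_trans; apply; rewrite gerBl invr_ge0.
elim: m => [|[|m] IHm]; first by rewrite big_ord0 invr0 subr0.
  by rewrite big_ord1 expr1n invr1; lra.
rewrite big_ord_recr/=; apply: le_trans (lerD IHm (lexx _)) _.
rewrite -addrA lerD2l -subr_ge0.
have m0 : 0 < m.+1%:R :> F by [].
have -> : m.+2%:R = m.+1%:R + 1 :> F by rewrite -natr1.
move: m.+1%:R m0 => x x0.
have -> : - (x + 1)^-1 - (- x^-1 + ((x + 1) ^+ 2)^-1) = (x * (x + 1) ^+ 2)^-1.
  by field; lra.
by rewrite invr_ge0 mulr_ge0 ?sqr_ge0 ?ltW.
Qed.

Lemma sum_inv_dist_sqr_le m i : (i <= m)%N ->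
  \sum_(j < m.+1 | j != i :> nat) ((j%:R - i%:R) ^+ 2)^-1 <= 4 :> F.
Proof.
move=> le_im; rewrite (big_ord_neq _ (fun j => ((j%:R - i%:R : F) ^+ 2)^-1))//=.
have -> : 4 = 2 + 2 :> F by lra.
apply: lerD; apply: le_trans (sum_inv_sqr_le _); apply: ler_sum => j _.
  by rewrite -sqrrN opprB natrB// subKr.
by rewrite natrD addrAC subrr add0r.
Qed.

(** The Weierstrass product inequality, used to control accumulated relative errors. *)
Lemma prod_1B_ge (I : Type) (r : seq I) (P : pred I) (e : I -> F) :
  (forall k, P k -> 0 <= e k <= 1) ->
  1 - \sum_(k <- r | P k) e k <= \prod_(k <- r | P k) (1 - e k).
Proof.
move=> e01; have p01 s : 0 <= \prod_(k <- s | P k) (1 - e k) <= 1.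
  apply: (big_ind (fun x => 0 <= x <= 1)) => [|x y|k /e01]; last 1 first.
  - by move=> /andP[? ?]; apply/andP; split; lra.
  - by rewrite ler01 lexx.
  - by move=> /andP[? ?] /andP[? ?]; rewrite mulr_ge0//= mulr_ile1.
elim: r => [|k r IHr]; first by rewrite !big_nil subr0.
rewrite !big_cons; case: ifPn => // /e01/andP[]; move: (p01 r) IHr.
set p := \prod_(_ <- _ | _) _; move=> /andP[] *; nra.
Qed.

(** For [M > 0], dividing by M^m m!^2 leaves factors at most 1 + 1/j^2, whose infinite product
    sinh(pi)/pi is below 4. *)
Lemma prod_sqrD_le m M a : 0 <= a <= M ->
  \prod_(j < m) (M * j.+1%:R ^+ 2 + a) <= 4 * M ^+ m * m`!%:R ^+ 2.
Proof.
move=> /andP[a0 aM]; have M0 := le_trans a0 aM.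
case: m => [|m]; first by rewrite big_ord0 fact0; lra.
(* The extra factor [m.+2 / m.+1] makes the induction go through. *)
suff : m.+2%:R * \prod_(j < m.+1) (M * j.+1%:R ^+ 2 + a)
    <= 4 * m.+1%:R * M ^+ m.+1 * m.+1`!%:R ^+ 2.
  move=> le_m; rewrite -(ler_pM2l (ltr0Sn F m.+1)); apply: le_trans le_m _.
  rewrite -!mulrA [_ * (4 * _)]mulrCA ler_pM2l// ler_wpM2r// ?ler_nat//.
  by rewrite mulr_ge0 ?exprn_ge0// sqr_ge0.
elim: m => [|m IHm].
  rewrite big_ord1 (_ : 1`! = 1)%N// !expr1n !mulr1 expr1; lra.
rewrite big_ord_recr factS natrM (exprS M m.+1) exprMn.
have := mulr_ge0 (exprn_ge0 m.+1 M0) (sqr_ge0 (m.+1`!%:R : F)).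
have : 0 <= \prod_(j < m.+1) (M * j.+1%:R ^+ 2 + a).
  by apply: prodr_ge0 => j _; rewrite addr_ge0// mulr_ge0// sqr_ge0.
move: IHm; set p := \prod_(_ < _) _; set u := M ^+ _; set f := _ ^+ 2.
have x1 : 0 <= m.+1%:R :> F by [].
have -> : m.+3%:R = m.+1%:R + 2 :> F by rewrite -addn2 natrD.
have -> : m.+2%:R = m.+1%:R + 1 :> F by rewrite -natr1.
move: (m.+1%:R) x1 => x x0 /= IHm p0 uf0.
have y0 : 0 < x + 1 by lra.
rewrite -(ler_pM2l y0); pose y := x + 1.
have -> : x + 2 = y + 1 by rewrite /y; lra.
have yM : M * y ^+ 2 + a <= M * (y ^+ 2 + 1) by lra.
apply: (@le_trans _ _ (((y + 1) * (M * (y ^+ 2 + 1))) * (4 * x * (u * f)))).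
  rewrite [leLHS](_ : _ = ((y + 1) * (M * y ^+ 2 + a)) * (y * p)); last first.
    by rewrite /y; ring.
  have y1 : 0 <= y + 1 by rewrite /y; lra.
  have My : 0 <= M * y ^+ 2 + a by rewrite addr_ge0// mulr_ge0// sqr_ge0.
  apply: ler_pM; [exact: mulr_ge0 | exact: mulr_ge0 (ltW y0) p0 | |].
    by rewrite ler_wpM2l.
  by move: IHm; rewrite -mulrA.
(* As [x = y - 1], the product (y + 1)(y^2 + 1) x is y^4 - 1, just below the y^4 on the right. *)
rewrite -subr_ge0 [leRHS](_ : _ = 4 * (M * (u * f))); last by rewrite /y; ring.
by rewrite mulr_ge0// mulr_ge0.
Qed.

(** Without [d] the product is at least M^m m!^2 / 2. The perturbation costs at most another factor
    2, because the relative errors sum to at most 4/8. *)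
Lemma prod_sqrB_ge m i M d : (i <= m)%N -> `|d| <= M / 8 ->
  M ^+ m * m`!%:R ^+ 2 / 4 <=
    \prod_(j < m.+1 | j != i :> nat) `|M * (j%:R ^+ 2 - i%:R ^+ 2) + d|.
Proof.
move=> le_im dM; have M0 : 0 <= M by have := normr_ge0 d; lra.
(* [e j] bounds the relative effect of [d] on factor [j], as
   [|j^2 - i^2| >= (j - i)^2]. *)
pose e (j : 'I_m.+1) : F := ((j%:R - i%:R) ^+ 2)^-1 / 8.
have ejF (j : 'I_m.+1) : j != i :> nat -> 1 <= (j%:R - i%:R : F) ^+ 2.
  move=> ji; rewrite -real_normK ?num_real// expr_ge1//.
  rewrite distrC; case: (ltngtP j i) ji => // lt_ji _.
    by rewrite -natrB ?ger0_norm ?ler1n ?subn_gt0// ltnW.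
  by rewrite -normrN opprB -natrB ?ger0_norm ?ler1n ?subn_gt0// ltnW.
have := prod_dist_sqr_ge le_im; rewrite -(ler_int F) intrM.
rewrite (big_morph intr (@intrM F) (erefl 1%:~R)) /= => le_f.
pose D (j : 'I_m.+1) : F := `|j%:R ^+ 2 - i%:R ^+ 2|.
have DE (j : 'I_m.+1) : `|j%:Z ^+ 2 - i%:Z ^+ 2|%:~R = D j.
  by rewrite intr_norm rmorphB !rmorphXn.
rewrite (eq_bigr D) // in le_f.
apply: (@le_trans _ _ (\prod_(j < m.+1 | j != i :> nat) (M * D j * (1 - e j)))); last first.
  apply: ler_prod => j ji; have d1 := ejF j ji.
  have D1 : (j%:R - i%:R) ^+ 2 <= D j.
    rewrite /D subr_sqr normrM -[leLHS]ger0_norm ?sqr_ge0// normrX expr2.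
    rewrite ler_wpM2l// [leRHS]ger0_norm ?addr_ge0//.
    by have := ler0n F j; have := ler0n F i; rewrite ler_norml; lra.
  have De : 1 / 8 <= D j * e j.
    by rewrite /e mulrA ler_pM2r ?invr_gt0// ler_pdivlMr; lra.
  have e1 : e j <= 1 by rewrite /e; have := invf_le1 (lt_le_trans ltr01 d1); rewrite d1; lra.
  apply/andP; split; first by rewrite !mulr_ge0 ?subr_ge0// /D.
  have := lerB_dist (M * (j%:R ^+ 2 - i%:R ^+ 2)) (- d).
  rewrite opprK normrN normrM (ger0_norm M0) -/(D j) => /(le_trans _); apply.
  by have := ler_wpM2l M0 De; rewrite mulrBr mulr1 -mulrA; lra.
rewrite big_split big_split /=.
have -> : \prod_(j < m.+1 | j != i :> nat) M = M ^+ m.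
  by rewrite (big_ord_neq _ (fun=> M))//= !prodr_const !card_ord -exprD subnKC.
have e2 : 1 / 2 <= \prod_(j < m.+1 | j != i :> nat) (1 - e j).
  apply: le_trans (prod_1B_ge _ _) => [|j ji].
    by rewrite -mulr_suml; have := sum_inv_dist_sqr_le le_im; lra.
  have d1 := ejF j ji; have d0 := lt_le_trans ltr01 d1.
  have := invf_le1 d0; rewrite d1 /e => ei; apply/andP; split; last by lra.
  by rewrite divr_ge0// invr_ge0 sqr_ge0.
rewrite -2!mulrA ler_wpM2l ?exprn_ge0//.
move: e2 le_f; rewrite -pmulrn natrX.
set f := m`!%:R ^+ 2; set X := \big[_/_]_(_ < _ | _) D _ => /= e2 le_f.
have -> : f / 4 = (f / 2) * (1 / 2) by lra.
apply: ler_pM => //; first by rewrite divr_ge0// sqr_ge0.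
  by lra.
by rewrite ler_pdivrMr// mulrC.
Qed.

End RealBounds.

(** * Clustered nodes and their Lagrange weights at -1 *)

(* Cluster [i] consists of the [b.+1] consecutive integers from
   [64 (b+1) i^2] on. *)
Definition node (b i r : nat) : nat := (64 * b.+1 * i ^ 2 + r)%N.

Lemma node_inj m b :
  injective (fun q : 'I_m.+1 * 'I_b.+1 => node b q.1 q.2).
Proof.
move=> [i r] [j s] /=; rewrite /node => e.
have eM k t : (t < b.+1)%N -> ((64 * b.+1 * k ^ 2 + t) %/ (64 * b.+1) = k ^ 2)%N.
  by move=> tb; rewrite mulnC divnMDl// divn_small ?addn0//; lia.
have eij : (i ^ 2 = j ^ 2 :> nat)%N by rewrite -(eM i r)// e eM.
have : (i : nat) = j by apply/eqP; rewrite -eqn_sqr eij.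
move: e; rewrite eij => /addnI/ord_inj -> /ord_inj -> //.
Qed.

(** Separates the other nodes of the same cluster from the other clusters. The latter are grouped by
    offset, since at a fixed offset they form a shifted quadratic family. *)
Lemma big_pair_neq (T : Type) (idx : T) (op : Monoid.com_law idx)
    (I J : finType) (G : I * J -> T) i0 j0 :
  \big[op/idx]_(q | q != (i0, j0)) G q =
    op (\big[op/idx]_(j | j != j0) G (i0, j))
       (\big[op/idx]_j \big[op/idx]_(i | i != i0) G (i, j)).
Proof.
rewrite exchange_big/=.
transitivity (\big[op/idx]_i \big[op/idx]_(j | (i, j) != (i0, j0)) G (i, j)).
  by rewrite pair_big_dep; apply: eq_big => -[].
rewrite (bigD1 i0)//=; congr (op _ _).
  by apply: eq_bigl => j; rewrite xpair_eqE eqxx.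
apply: eq_bigr => i ii0; apply: eq_bigl => j.
by rewrite xpair_eqE (negbTE ii0).
Qed.

Section Weights.
Variable F : realFieldType.

Lemma node_natr b i r :
  (node b i r)%:R = (64 * b.+1)%:R * i%:R ^+ 2 + r%:R :> F.
Proof. by rewrite /node natrD natrM natrX. Qed.

(** Bounds the distances from -1. Cluster 0 contributes (b + 1)!; at each offset [r] the other
    clusters fall under [prod_sqrD_le] with [a = r.+1]. *)
Lemma prod_node_le m b :
  \prod_(q : 'I_m.+1 * 'I_b.+1) (node b q.1 q.2).+1%:R <=
    b.+1`!%:R * (4 * (64 * b.+1)%:R ^+ m * m`!%:R ^+ 2) ^+ b.+1 :> F.
Proof.
rewrite -(pair_bigA _ (fun (i : 'I_m.+1) (r : 'I_b.+1) => (node b i r).+1%:R : F)) /=.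
rewrite exchange_big/= -[b.+1 in X in _ * _ ^+ X]card_ord -prodr_const.
have -> : b.+1`! = \prod_(r < b.+1) r.+1.
  by rewrite fact_prod big_add1 big_mkord.
rewrite natr_prod -big_split/=.
apply: ler_prod => r _; rewrite prodr_ge0//=.
rewrite big_ord_recl /node /= muln0 add0n ler_wpM2l//.
apply: le_trans (@prod_sqrD_le _ m _ r.+1%:R _); last first.
  by apply/andP; split; [exact: ler0n|]; rewrite ler_nat (leq_trans (ltn_ord r))// leq_pmull.
by apply: ler_prod => j _; rewrite ler0n/= -natrX -natrM -natrD addnS.
Qed.

(** The node's own cluster gives r! (b - r)!. At each offset [s] the other clusters fall under
    [prod_sqrB_ge] with [d = s - r], which is small against 64 (b + 1). *)
Lemma prod_node_dist_ge m b (i : 'I_m.+1) (r : 'I_b.+1) :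
  (r`! * (b - r)`!)%:R * ((64 * b.+1)%:R ^+ m * m`!%:R ^+ 2 / 4) ^+ b.+1 <=
  \prod_(q : 'I_m.+1 * 'I_b.+1 | q != (i, r))
     `|(node b i r)%:R - (node b q.1 q.2)%:R| :> F.
Proof.
rewrite big_pair_neq /= ler_pM ?exprn_ge0 ?divr_ge0 ?mulr_ge0 ?exprn_ge0//.
  under eq_bigr => s _.
    rewrite /node !natrD opprD addrACA subrr add0r -normrN opprB.
    rewrite !pmulrn -rmorphB -intr_norm; over.
  rewrite -(big_morph intr (@intrM F) (erefl 1%:~R)).
  rewrite (eq_bigl (fun s : 'I__ => s != r :> nat))// prod_dist_ord; last by rewrite -ltnS.
  exact: lexx.
rewrite -[b.+1 in X in _ ^+ X <= _]card_ord -prodr_const.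
apply: ler_prod => s _; apply/andP; split.
  by rewrite divr_ge0// mulr_ge0// exprn_ge0.
apply: le_trans (@prod_sqrB_ge _ m i (64 * b.+1)%:R (s%:R - r%:R) _ _) _.
- by rewrite -ltnS.
- rewrite natrM; have : (s%:R <= b%:R :> F) /\ (r%:R <= b%:R :> F).
    by split; rewrite ler_nat -ltnS ltn_ord.
  have := ler0n F s; have := ler0n F r; rewrite ler_norml -natr1; lra.
rewrite le_eqVlt; apply/orP; left; apply/eqP; apply: eq_bigr => j _.
by rewrite -normrN !node_natr; congr `|_|; move: (64 * b.+1)%:R => M; ring.
Qed.

(** In the quotient of the two previous bounds the powers of M and m! cancel, leaving 4 / (1/4) = 16
    per offset and (b + 1)! / (r! (b - r)!). The last denominator is the node's own factor, absent
    from the numerator. *)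
Lemma lagrange_weight_le m b (i : 'I_m.+1) (r : 'I_b.+1) :
  `|\prod_(q : 'I_m.+1 * 'I_b.+1 | q != (i, r))
     ((- 1 - (node b q.1 q.2)%:R) / ((node b i r)%:R - (node b q.1 q.2)%:R))| <=
  16 ^+ b.+1 * (b.+1 * 'C(b, r))%:R / (node b i r).+1%:R :> F.
Proof.
rewrite normr_prod.
under eq_bigr => q _.
  rewrite normrM normfV -opprD normrN addrC natr1 normr_nat; over.
rewrite prodf_div.
have := prod_node_le m b; rewrite (bigD1 (i, r))//= => le_num.
have := prod_node_dist_ge i r => ge_den.
set X := _ ^+ m * _ in le_num ge_den.
have X0 : 0 < X by rewrite mulr_gt0 ?exprn_gt0 ?ltr0n ?fact_gt0.
have le_rb : (r <= b)%N by rewrite -ltnS.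
move: le_num ge_den; set N := \prod_(_ | _) _; set D := \prod_(_ | _) _ => le_num ge_den.
have D0 : 0 < D.
  apply: lt_le_trans ge_den; rewrite mulr_gt0 ?ltr0n ?muln_gt0 ?fact_gt0//.
  by rewrite exprn_gt0// divr_gt0.
rewrite ler_pdivrMr// mulrAC ler_pdivlMr// mulrC.
apply: le_trans le_num _; rewrite -mulrA -/X.
apply: le_trans (ler_wpM2l _ ge_den); last by rewrite mulr_ge0// exprn_ge0.
have -> : 4 * X = 16 * (X / 4) by lra.
rewrite factS -(bin_fact le_rb) exprMn mulnA [in leLHS]natrM.
by rewrite le_eqVlt; apply/orP; left; apply/eqP; rewrite mulrACA; congr (_ * _); exact: mulrC.
Qed.

End Weights.

(** * Extrapolation from the nodes to -1 *)

Section Extrapolation.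
Variable F : realFieldType.
Implicit Types p : {poly F}.

Lemma horner_N1_le m b p : (size p <= m.+1 * b.+1)%N ->
  `|p.[- 1]| <= \sum_(i < m.+1) \sum_(r < b.+1) `|p.[(node b i r)%:R]| *
     (16 ^+ b.+1 * (b.+1 * 'C(b, r))%:R / (node b i r).+1%:R).
Proof.
move=> le_p; pose y (q : 'I_m.+1 * 'I_b.+1) : F := (node b q.1 q.2)%:R.
have y_inj : injective y.
  by move=> q1 q2 /eqP; rewrite eqr_nat => /eqP/node_inj.
rewrite (horner_lagrange _ y_inj) ?card_prod ?card_ord//.
rewrite pair_bigA /=; apply: le_trans (ler_norm_sum _ _ _) _.
apply: ler_sum => -[i r] _; rewrite normrM ler_wpM2l//.
exact: lagrange_weight_le.
Qed.

Lemma horner_N1_le_expn m b N p : (size p <= m.+1 * b.+1)%N ->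
  (64 * b.+1 * m ^ 2 + b <= N)%N ->
  (forall t : nat, (t <= N)%N -> `|p.[t%:R]| <= 1) ->
  `|p.[- 1]| <= 64 ^+ b.+1.
Proof.
move=> le_p le_N p1; apply: le_trans (horner_N1_le le_p) _.
pose c r : F := 16 ^+ b.+1 * (b.+1 * 'C(b, r))%:R.
have c0 r : 0 <= c r by rewrite mulr_ge0// exprn_ge0.
(* [g] dominates the inverse of [(node b i r).+1], uniformly in [r], and has sum at most 1 + 2. *)
pose g (i : nat) : F := if i is i'.+1 then (i'.+1%:R ^+ 2)^-1 else 1.
apply: (@le_trans _ _ (\sum_(i < m.+1) \sum_(r < b.+1) g i * c r)).
  apply: ler_sum => i _; apply: ler_sum => r _; rewrite -[leRHS]mul1r.
  apply: ler_pM => //; first by rewrite divr_ge0// c0.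
    apply: p1; rewrite (leq_trans _ le_N)// /node leq_add ?leq_mul ?leq_sqr//; by rewrite -ltnS.
  rewrite mulrC ler_wpM2r ?c0// /g; case: (i : nat) => [|k].
    by rewrite invf_le1// ler1n.
  rewrite lef_pV2 ?posrE ?exprn_gt0//.
  rewrite -natrX ler_nat /node; lia.
under eq_bigr => i _ do rewrite -mulr_sumr.
rewrite -mulr_suml.
have g3 : \sum_(i < m.+1) g i <= 3.
  rewrite big_ord_recl /=; have := sum_inv_sqr_le F m.
  by rewrite -[3]/(1 + 2) lerD2l.
have -> : \sum_(r < b.+1) c r = 16 ^+ b.+1 * (b.+1 * 2 ^ b)%:R.
  rewrite -mulr_sumr -natr_sum -big_distrr /=; congr (_ * (_ * _)%:R).
  by rewrite -[2%N]/(1 + 1)%N Pascal; apply: eq_bigr => r _; rewrite !exp1n !muln1.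
apply: le_trans (ler_wpM2r _ g3) _; first by rewrite mulr_ge0// exprn_ge0.
have -> : 64 = 16 * 4 :> F by lra.
rewrite exprMn mulrCA ler_wpM2l ?exprn_ge0// -natrX -natrM ler_nat.
(* What remains is 3 (b + 1) 2^b <= 4^(b + 1), which follows from b + 1 <= 2^b. *)
rewrite expnS -[(4 ^ b)%N]/((2 * 2) ^ b)%N expnMn.
have : (b.+1 <= 2 ^ b)%N by exact: ltn_expl.
set u := (2 ^ b)%N; nia.
Qed.

(** Take [b = 0]. The node 0 carries no mass as [p.[0] = 0], and node 64 i^2 has weight at most 16 /
    (64 i^2) = 1 / (4 i^2); these sum to at most 1/2. *)
Lemma horner_N1_le_half m N p : (size p <= m.+1)%N ->
  (64 * m ^ 2 <= N)%N -> p.[0] = 0 ->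
  (forall t : nat, (t <= N)%N -> `|p.[t%:R]| <= 1) ->
  `|p.[- 1]| <= 1 / 2.
Proof.
move=> le_p le_N p0 p1; apply: le_trans (@horner_N1_le m 0 p _) _.
  by rewrite muln1.
rewrite big_ord_recl big_ord1 /= /node !muln0 p0 normr0 mul0r add0r.
apply: (@le_trans _ _ (\sum_(i < m) (i.+1%:R ^+ 2)^-1 * (1 / 4))).
  apply: ler_sum => i _; rewrite big_ord1 -[leRHS]mul1r.
  apply: ler_pM => //; first by rewrite divr_ge0// mulr_ge0.
    apply: p1; rewrite (leq_trans _ le_N)// muln1 addn0 leq_mul ?leq_sqr//.
  rewrite expr1 bin0 muln1 mulr1 !addn0 ler_pdivrMr// mulrAC.
  rewrite -mulrA ler_pdivlMl ?exprn_gt0// (_ : bump 0 i = i.+1)// muln1 -[X in X * (1 / 4)]natr1 natrM natrX.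
  by have := sqr_ge0 (i.+1%:R : F); lra.
rewrite -mulr_suml.
by have := sum_inv_sqr_le F m; lra.
Qed.

End Extrapolation.

(** * Symmetrization over the slices of the cube *)

(** Double counting of [t]-subsets together with an ordered list of [e] distinct members. *)
Lemma bin_mul_ffact n t e : (e <= n)%N -> (t <= n)%N ->
  ('C(n - e, n - t) * n ^_ e = 'C(n, t) * t ^_ e)%N.
Proof.
move=> le_en le_tn; case: (leqP e t) => [le_et|lt_te]; last first.
  by rewrite bin_small ?mul0n ?ffact_small ?muln0//; lia.
apply/eqP; rewrite -(eqn_pmul2r (fact_gt0 (n - t))) -(eqn_pmul2r (fact_gt0 (t - e))).
apply/eqP; have := @bin_fact (n - e) (n - t).
rewrite leq_sub2l// (_ : n - e - (n - t) = t - e)%N; last lia.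
move=> /(_ isT) e1; have e2 := ffact_fact le_en.
have e3 := bin_fact le_tn; have e4 := ffact_fact le_et.
transitivity (n ^_ e * ('C(n - e, n - t) * ((n - t)`! * (t - e)`!)))%N; first by ring.
rewrite e1 e2 -e3 -e4; ring.
Qed.

(** Complements are subsets of [~: S]. Choosing [#|T| - t] elements keeps the count 0 when
    [t < #|S|], where [t - #|S|] would truncate. *)
Lemma card_supersets (T : finType) (S : {set T}) t : (t <= #|T|)%N ->
  #|[set A : {set T} | S \subset A & #|A| == t]| = 'C(#|T| - #|S|, #|T| - t).
Proof.
move=> le_t; have -> : (#|T| - #|S| = #|~: S|)%N by rewrite [RHS]cardsCs setCK.
rewrite -(cards_draws (~: S)).
rewrite -(card_imset _ (@setC_inj T)); apply: eq_card => B.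
rewrite -[B]setCK (mem_imset _ _ (@setC_inj T)) !inE setCS; congr (_ && _).
rewrite [in RHS]cardsCs setCK; have := max_card (mem (~: B)).
move: #|~: B| => c le_c; apply/eqP/eqP; lia.
Qed.

Section Symmetrization.
Variables (R : realType) (n : nat).
Implicit Types (s : {mpoly R[n]}) (x : {ffun 'I_n -> bool}).

Definition hamming x : nat := \sum_i x i.

Lemma weightE x : weight R x = (hamming x)%:R.
Proof. by rewrite /weight natr_sum. Qed.

Lemma hammingE x : hamming x = #|[set i | x i]|.
Proof.
rewrite /hamming -sum1_card [RHS](eq_bigl (fun i => x i)) => [|i]; last by rewrite inE.
by rewrite [RHS]big_mkcond; apply: eq_bigr => i _; case: (x i).
Qed.

Lemma sum_slice (V : nmodType) (f : {set 'I_n} -> V) t :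
  \sum_(x | hamming x == t) f [set i | x i] = \sum_(A : {set 'I_n} | #|A| == t) f A.
Proof.
rewrite (reindex (fun A : {set 'I_n} => [ffun i => i \in A])) /=.
  have e (A : {set 'I_n}) : [set i | [ffun i => i \in A] i] = A :> {set 'I_n}.
    by apply/setP => i; rewrite inE ffunE.
  by apply: eq_big => A; rewrite ?hammingE e.
exists (fun x => [set i | x i]) => [A _|x _].
  by apply/setP => i; rewrite inE ffunE.
by apply/ffunP => i; rewrite ffunE inE.
Qed.

Lemma cube_evalX (u : 'X_{1..n}) x :
  cube_eval ('X_[R, u]) x = ([set i | u i != 0%N] \subset [set i | x i])%:R.
Proof.
rewrite /cube_eval mevalX; case: (boolP (_ \subset _)) => [/subsetP S|/subsetPn[i]].
  rewrite big1// => i _; have := S i; rewrite !inE.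
  by case: (u i) => // k /(_ isT) ->; rewrite expr1n.
rewrite !inE => ui xi; rewrite (bigD1 i)//= (negbTE xi) expr0n (negbTE ui) mul0r//.
Qed.

Definition falling_poly e : {poly R} := \prod_(i < e) ('X - i%:R%:P).

Lemma size_falling_poly e : size (falling_poly e) = e.+1.
Proof. by rewrite /falling_poly size_prod_XsubC /index_enum -enumT size_enum_ord. Qed.

Lemma horner_falling_poly e t : (falling_poly e).[t%:R] = (t ^_ e)%:R.
Proof.
rewrite /falling_poly horner_prod ffact_prod natr_prod.
case: (leqP e t) => [le_et|lt_te].
  apply: eq_bigr => i _; rewrite hornerXsubC natrB//.
  by rewrite (leq_trans _ le_et)// ltnW.
by rewrite (bigD1 (Ordinal lt_te))//= [RHS](bigD1 (Ordinal lt_te))//=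
  hornerXsubC subrr subnn !mul0r.
Qed.

(** Minsky-Papert symmetrization: on the cube a monomial depends only on its support, and for a
    support of size [e] its average over slice [t] is t^_e / n^_e, a polynomial in [t] of degree
    [e]. *)
Lemma symmetrization s d : deg_le s d ->
  exists p : {poly R}, (size p <= d.+1)%N /\
    forall t, (t <= n)%N ->
      \sum_(x | hamming x == t) cube_eval s x = 'C(n, t)%:R * p.[t%:R].
Proof.
move=> le_sd; pose S (u : 'X_{1..n}) := [set i | u i != 0%N].
have le_S u : (#|S u| <= mdeg u)%N.
  rewrite mdegE -sum1_card [leqLHS]big_mkcond; apply: leq_sum => i _.
  by rewrite inE; case: (u i).
have le_Sn u : (#|S u| <= n)%N by rewrite -[leqRHS]card_ord max_card.
exists (\sum_(u <- msupp s) (s@_u / (n ^_ #|S u|)%:R) *: falling_poly #|S u|); split.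
  rewrite (leq_trans (size_sum _ _ _))//; apply/bigmax_leqP_seq => u us _.
  rewrite (leq_trans (size_scale_leq _ _))// size_falling_poly ltnS.
  rewrite (leq_trans (le_S u))// -ltnS (leq_trans _ le_sd)//.
  exact: msize_mdeg_lt.
move=> t le_tn; rewrite horner_sum mulr_sumr.
transitivity (\sum_(u <- msupp s) s@_u * \sum_(x | hamming x == t) cube_eval 'X_[u] x).
  under [RHS]eq_bigr => u _ do rewrite mulr_sumr.
  rewrite [RHS]exchange_big /=.
  apply: eq_bigr => x _; rewrite /cube_eval mevalE.
  by apply: eq_bigr => u _; rewrite mevalX.
apply: eq_bigr => u _; under eq_bigr => x _ do rewrite cube_evalX.
rewrite (sum_slice (fun A => (S u \subset A)%:R : R)).
rewrite hornerZ horner_falling_poly mulrA mulrCA -2!mulrA; congr (_ * _).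
have -> : \sum_(A : {set 'I_n} | #|A| == t) (S u \subset A)%:R = 'C(n - #|S u|, n - t)%:R :> R.
  have := @card_supersets _ (S u) t; rewrite card_ord => /(_ le_tn) <-.
  rewrite -natr_sum -sum1_card big_mkcond [in RHS]big_mkcond; congr _%:R.
  by apply: eq_bigr => A _; rewrite inE; case: (_ == t); case: (_ \subset _).
have f0 : (n ^_ #|S u|)%:R != 0 :> R by rewrite pnatr_eq0 -lt0n ffact_gt0.
apply: (mulIf f0); rewrite -natrM bin_mul_ffact// natrM.
by rewrite -mulrA mulrAC mulVf ?mul1r.
Qed.

Lemma cube_eval_sos_ge0 s x : is_sos s -> 0 <= cube_eval s x.
Proof.
case=> ps ->; rewrite /cube_eval raddf_sum /=; apply: sumr_ge0 => p _.
by rewrite rmorphXn sqr_ge0.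
Qed.

(** Average the certificate over a slice, where the weight is constant, and drop the nonnegative
    [s0]; [p] is the symmetrized [s1]. *)
Lemma certificate_slice (q : R) d : sos_certificate n q d ->
  exists p : {poly R}, (size p <= (2 * d).+1)%N /\
    forall t, (t <= n)%N -> 0 <= p.[t%:R] /\
      p.[t%:R] * (t%:R - q) <= t%:R - (Num.ceil q)%:~R.
Proof.
move=> [s0 [s1 [sos0 sos1 _ deg1 cert]]].
have [p [size_p pE]] := symmetrization deg1.
exists p; split=> // t le_tn; have C0 : 0 < 'C(n, t)%:R :> R by rewrite ltr0n bin_gt0.
split; first by rewrite -(pmulr_rge0 _ C0) -pE// sumr_ge0// => x _; exact: cube_eval_sos_ge0.
rewrite -(ler_pM2l C0) mulrA -pE// mulr_suml.
have -> : 'C(n, t)%:R = \sum_(x | hamming x == t) 1 :> R.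
  rewrite (sum_slice (fun=> 1%:R)) -natr_sum sum1dep_card; congr _%:R.
  by rewrite -[in LHS](card_ord n) -card_draws.
rewrite mulr_suml; apply: ler_sum => x /eqP xt; rewrite mul1r.
have := cert x; rewrite weightE xt => ->.
by rewrite lerDr cube_eval_sos_ge0.
Qed.

End Symmetrization.

(** * Degree bounds forced by a certificate *)

Section RankBounds.
Variables (R : realType) (n k d : nat) (q : R).
Hypotheses (kn : (k < n %/ 2)%N) (kq : k%:R < q < k.+1%:R).
Hypothesis cert : sos_certificate n q d.

(** The shift sends k to -1 and k + 1 to 0. The slice inequality reads p(k)(k - q) <= -1 at k and
    p(k + 1)(k + 1 - q) <= 0 at k + 1; from there on, a value above 1 would push the left side past
    t - (k + 1). *)
Lemma certificate_poly :
  exists p : {poly R}, [/\ (size p <= (2 * d).+1)%N,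
    1 / (q - k%:R) <= p.[- 1], p.[0] = 0 &
    forall t : nat, (t <= n - k.+1)%N -> `|p.[t%:R]| <= 1].
Proof.
have /andP[kq0 kq1] := kq.
have [p [size_p pE]] := certificate_slice cert.
have ceilE : Num.ceil q = k.+1%:Z.
  apply: ceil_def; apply/andP; split; last by rewrite -pmulrn ltW.
  by rewrite (_ : k.+1%:Z - 1 = k%:Z); [rewrite -pmulrn | lia].
rewrite ceilE -pmulrn in pE.
have le_kn : (k.+1 <= n)%N by apply: leq_trans kn _; exact: leq_div.
have shiftE (x : R) : (p \Po ('X + k.+1%:R%:P)).[x] = p.[x + k.+1%:R].
  by rewrite horner_comp hornerD hornerX hornerC.
exists (p \Po ('X + k.+1%:R%:P)); split.
- by rewrite size_comp_poly2// size_XaddC.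
- rewrite shiftE (_ : - 1 + k.+1%:R = k%:R); last by rewrite -natr1; lra.
  have [_] := pE k (ltnW le_kn); rewrite -natr1 ler_pdivrMr ?subr_gt0//.
  lra.
- rewrite shiftE add0r; have [p0 p1] := pE _ le_kn.
  apply/eqP; rewrite eq_le p0 andbT.
  by move: p1; rewrite subrr pmulr_lle0// subr_gt0.
move=> t le_t; rewrite shiftE -natrD.
have le_tn : (t + k.+1 <= n)%N by lia.
have [p0 p1] := pE _ le_tn; rewrite ger0_norm//.
move: p0 p1; set P := p.[_] => p0; rewrite natrD addrK => p1.
have t0 : 0 <= t%:R :> R by [].
rewrite leNgt; apply/negP => P1.
have : (t%:R + k.+1%:R - q) < P * (t%:R + k.+1%:R - q) by rewrite ltr_pMl//; lra.
lra.
Qed.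

Lemma degree_ge_sqrt : (n <= 512 * d ^ 2)%N.
Proof.
have /andP[kq0 kq1] := kq.
have [p [size_p p_N1 p0 p1]] := certificate_poly.
rewrite leqNgt; apply/negP => lt_dn.
(* [kn] gives n - (k + 1) >= n / 2, while 64 (2 d)^2 = 256 d^2. *)
have le_N : (64 * (2 * d) ^ 2 <= n - k.+1)%N by rewrite expnMn; lia.
have := horner_N1_le_half size_p le_N p0 p1; have := ler_norm p.[- 1].
have : 1 < 1 / (q - k%:R).
  by rewrite ltr_pdivlMr ?subr_gt0// mul1r -natr1 in kq1 *; lra.
lra.
Qed.

Lemma degree_ge_log : (128 * d <= n)%N ->
  1 / (q - k%:R) <= 64 ^+ ((1024 * d ^ 2) %/ n).+1.
Proof.
move=> le_dn; have [p [size_p p_N1 p0 p1]] := certificate_poly.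
(* Clusters of size [b.+1], with [m] such that [m.+1] of them supply more than 2 d nodes. *)
set b := (_ %/ _)%N; pose m := (2 * d %/ b.+1)%N.
have n0 : (0 < n)%N by case: n kn.
apply: le_trans p_N1 _; apply: le_trans (ler_norm _) _.
apply: (@horner_N1_le_expn _ m b (n - k.+1)) => //.
  by apply: leq_trans size_p _; rewrite /m; apply: ltn_ceil.
have b1 : (1024 * d ^ 2 < b.+1 * n)%N by exact: ltn_ceil.
have b2 : (b * n <= 1024 * d ^ 2)%N by exact: leq_divM.
have m1 : (m * b.+1 <= 2 * d)%N by exact: leq_divM.
(* Here [128 * d <= n] enters, through (128 d)^2 = 16 * 1024 d^2. *)
have b3 : (b * 16 <= n)%N.
  rewrite -(leq_pmul2r n0); apply: (@leq_trans (16 * (1024 * d ^ 2))); first by lia.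
  have := leq_mul le_dn le_dn; lia.
(* The last cluster thus starts at or below n / 4; with b <= n / 16 all nodes stay below n / 2. *)
have m2 : (256 * (b.+1 * m ^ 2) <= n)%N.
  rewrite -(leq_pmul2r (ltn0Sn b)).
  apply: (@leq_trans (256 * (2 * d) ^ 2)); last by rewrite expnMn; lia.
  have := leq_mul m1 m1; rewrite -!mulnn; lia.
have : (n %/ 2 * 2 <= n)%N by exact: leq_divM.
rewrite -mulnA; lia.
Qed.

End RankBounds.

Theorem theorem1p1 (R : realType) :
  exists c1 c2 : R,
    [/\ 0 < c1, 0 < c2 &
      forall (n : nat) (q : R), (1 <= n)%N -> 0 < q < (n %/ 2)%:R ->
        let qh := q - (Num.floor q)%:~R in
        qh != 0 ->
        (0 < qh <= 1 / 2 ->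
           c1 * Num.min n%:R (Num.sqrt (n%:R * ln (1 / qh)))
             <= (sos_rank n q)%:R) /\
        (1 / 2 < qh < 1 ->
           c2 * Num.sqrt (n%:R * (1 - qh)) <= (sos_rank n q)%:R)].
Proof.
(* 128 matches the threshold in [degree_ge_log]; 23 exceeds the square root of 512. *)
exists (1 / 128), (1 / 23); split; [lra | lra |].
move=> n q n1 /andP[q0 qn] qh qh0.
have cert : sos_certificate n q (sos_rank n q).
  by rewrite /sos_rank; case: ex_minnP => d /asboolP.
move: (sos_rank n q) cert => d cert.
have [k kE] : exists k : nat, Num.floor q = k%:Z.
  by have := ltW q0; rewrite -floor_ge0; case: (Num.floor q) => // k _; exists k.
have := floor_itv q; rewrite kE intrD -!pmulrn natr1 => /andP[le_kq lt_qk].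
move: qh0; rewrite /qh kE -pmulrn => qh0.
have kq : k%:R < q < k.+1%:R.
  by rewrite lt_qk andbT lt_neqAle le_kq andbT eq_sym -subr_eq0.
have kn : (k < n %/ 2)%N by rewrite -(ltr_nat R); case/andP: kq => + _; move/lt_trans; apply.
have n_le : n%:R <= 512 * d%:R ^+ 2 :> R.
  by rewrite -natrX -natrM ler_nat; exact: degree_ge_sqrt kn kq cert.
have d0 : 0 <= d%:R :> R by [].
have n0 : 0 <= n%:R :> R by [].
have le_sqrt (c x : R) : 0 <= c -> x <= (c * d%:R) ^+ 2 -> Num.sqrt x <= c * d%:R.
  by move=> c0 /ler_wsqrtr; rewrite sqrtr_sqr ger0_norm ?mulr_ge0.
move: (q - k%:R) (@degree_ge_log R n k d q kn kq cert) => h le_h.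
split=> [/andP[h0 h1]|/andP[h0 h1]]; last first.
  have : Num.sqrt (n%:R * (1 - h)) <= 23 * d%:R.
    apply: le_sqrt => //; have : n%:R * (1 - h) <= n%:R * 1 by rewrite ler_wpM2l//; lra.
    by rewrite exprMn; have := sqr_ge0 (d%:R : R); lra.
  lra.
have [le_dn|lt_nd] := leqP (128 * d) n; last first.
  have : n%:R <= 128 * d%:R :> R by rewrite -natrM ler_nat ltnW.
  have : Num.min n%:R (Num.sqrt (n%:R * ln (1 / h))) <= n%:R by rewrite ge_min lexx.
  lra.
have : Num.min n%:R (Num.sqrt (n%:R * ln (1 / h))) <= Num.sqrt (n%:R * ln (1 / h)).
  by rewrite ge_min lexx orbT.
suff : Num.sqrt (n%:R * ln (1 / h)) <= 128 * d%:R by lra.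
apply: le_sqrt => //.
move: (le_h le_dn); set b := (_ %/ _)%N => hb.
have hi : 0 < 1 / h by rewrite divr_gt0.
(* The 6 comes from 64 = 2^6 and ln 2 <= 1. *)
have ln_h : ln (1 / h) <= 6 * b.+1%:R.
  apply: (@le_trans _ _ (ln (64 ^+ b.+1))).
    by rewrite ler_ln// posrE exprn_gt0.
  rewrite lnXn// -[leLHS]mulr_natr ler_wpM2r//.
  have -> : 64 = 2 ^+ 6 :> R by lra.
  rewrite lnXn// -[leLHS]mulr_natr; have := @le_ln1Dx R 1.
  have -> : 1 + 1 = 2 :> R by lra.
  by move=> /(_ ltac:(lra)); lra.
have bn : b%:R * n%:R <= 1024 * d%:R ^+ 2 :> R.
  by rewrite -natrM -natrX -natrM ler_nat; exact: leq_divM.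
(* With [bn] and [n_le], 6 n (b + 1) <= 6 (1024 + 512) d^2 = (96 d)^2, within (128 d)^2. *)
apply: le_trans (ler_wpM2l n0 ln_h) _.
rewrite -natr1 exprMn; have := sqr_ge0 (d%:R : R); lra.
Qed.
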